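(* Let $\beta\leq 0$ and let $p$ be an analytic function on $\mathbb{D}$ with $p(0)=1$ satisfying $$p(z)+\beta\,\frac{zp'(z)}{p^{2}(z)}\prec\varphi_{CAR}(z).$$ Then $p(z)\prec\frac{1+z}{1-z}$.
   Context: $\mathbb{D}$ is the open unit disc in $\mathbb{C}$. $\varphi_{CAR}(z)=1+\frac{4z}{3}+\frac{2z^2}{3}$. For analytic functions $f,g$ on $\mathbb{D}$, $f\prec g$ ($f$ is subordinate to $g$) means there is an analytic $w:\mathbb{D}\to\mathbb{D}$ with $w(0)=0$ and $f(z)=g(w(z))$ for all $z\in\mathbb{D}$; in particular a subordination hypothesis includes that its left-hand side is analytic on $\mathbb{D}$. *)

(* Defs.v *)
From Stdlib Require Export Reals.
From Coquelicot Require Export Coquelicot.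
Open Scope C_scope.

Definition unit_disc (z : C) : Prop := (Cmod z < 1)%R.

(** Functions on the disc are represented by total functions [C -> C] whose
    values outside the disc are irrelevant: the disc is open, so complex
    differentiability at its points depends only on the values inside it. *)
Definition analytic_on_disc (f : C -> C) : Prop :=
  forall z : C, unit_disc z ->
    ex_derive (K := C_AbsRing) (V := C_NormedModule) f z.

Definition subordinate (f g : C -> C) : Prop :=
  analytic_on_disc f /\ analytic_on_disc g /\
  exists w : C -> C,
    analytic_on_disc w /\
    (forall z : C, unit_disc z -> unit_disc (w z)) /\
    w 0 = 0 /\
    (forall z : C, unit_disc z -> f z = g (w z)).

Definition phi_CAR (z : C) : C := 1 + 4 * z / 3 + 2 * z ^ 2 / 3.

(* Main.v *)
(** Put [F z = p z + beta z p'(z) / p(z)^2]. Since Re phi_CAR > (1 + 2 Re w)^2 / 3 >= 0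
    on the disc, Re F > 0. Follow a ray [t z], [0 <= t <= 1]: if
    [p (t z) = i y] with [y <> 0], then Re F = - beta Re (t z p'(t z)) / y^2,
    so the radial derivative of Re p is positive wherever Re p vanishes. As
    Re p = 1 at the origin, Re p can never reach 0 from above along the ray. Hence
    Re p > 0, and [w = (p - 1) / (p + 1)] is the required Schwarz function. *)

From Stdlib Require Import Lra Classical.
Require Import Defs.

(** Linearity of the differential is automatic, and a neighbourhood filter converges only to its own
    centre, so the filter definition reduces to this estimate. *)
Lemma is_derive_C_eps (f : C -> C) (z l : C) :
  is_derive (K := C_AbsRing) (V := C_NormedModule) f z l <->
  forall eps : posreal, exists delta : posreal, forall y : C,
    (Cmod (y - z) < delta)%R ->
    (Cmod (f y - f z - (y - z) * l) <= eps * Cmod (y - z))%R.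
Proof.
split.
- intros [_ H] eps.
  exact (H z (fun P HP => HP) eps).
- intros H; split.
  + apply is_linear_scal_l.
  + intros x Hx eps.
    rewrite <- (is_filter_lim_locally_unique
      (V := AbsRing_NormedModule C_AbsRing) z x Hx).
    exact (H eps).
Qed.

Lemma is_derive_Cinv (z : C) : z <> 0 ->
  is_derive (K := C_AbsRing) (V := C_NormedModule) Cinv z (- / (z * z)).
Proof.
intros Hz; apply is_derive_C_eps; intros eps.
assert (Hm : (0 < Cmod z)%R) by now apply Cmod_gt_0.
(* The first bound gives [|y| > |z|/2]; with it, the second keeps the factor [|y - z| / (|y| |z|^2)]
   of the remainder below [eps]. *)
assert (Hd : (0 < Rmin (Cmod z / 2) (eps * (Cmod z * Cmod z * Cmod z) / 2))%R).
{ pose proof (cond_pos eps).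
  assert (0 < Cmod z * Cmod z * Cmod z)%R by (repeat apply Rmult_lt_0_compat; assumption).
  apply Rmin_pos; [lra | nra]. }
exists (mkposreal _ Hd); intros y Hy; simpl in Hy.
pose proof (Rlt_le_trans _ _ _ Hy (Rmin_l _ _)) as Hy1.
pose proof (Rlt_le_trans _ _ _ Hy (Rmin_r _ _)) as Hy2.
assert (Hym : (Cmod z / 2 < Cmod y)%R).
{ pose proof (Cmod_triangle y (- (y - z))) as T.
  rewrite Cmod_opp in T; replace (y + - (y - z)) with z in T by ring; lra. }
assert (Hy0 : y <> 0) by (apply Cmod_gt_0; lra).
replace (/ y - / z - (y - z) * - / (z * z))
  with ((y - z) * ((y - z) / (y * (z * z)))) by (field; auto).
assert (Hyzz : y * (z * z) <> 0) by (repeat apply Cmult_neq_0; assumption).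
rewrite Cmod_mult, Cmod_div, !Cmod_mult, (Rmult_comm eps) by assumption.
apply Rmult_le_compat_l; [apply Cmod_ge_0 |].
apply Rle_div_l; [repeat apply Rmult_lt_0_compat; lra |].
assert (0 < eps * (Cmod z * Cmod z))%R
  by (pose proof (cond_pos eps); repeat apply Rmult_lt_0_compat; lra).
nra.
Qed.

(* Both targets carry the norm [Cmod], but [C_NormedModule] has the product
   topology, so the two normed modules are not convertible. *)
Lemma is_derive_C_AbsRing (f : C -> C) (z l : C) :
  is_derive (K := C_AbsRing) (V := C_NormedModule) f z l <->
  is_derive (K := C_AbsRing) (V := AbsRing_NormedModule C_AbsRing) f z l.
Proof.
split; intros [_ H]; (split; [apply is_linear_scal_l | exact H]).
Qed.

Lemma ex_derive_Cdiv (f g : C -> C) (z : C) :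
  ex_derive (K := C_AbsRing) (V := C_NormedModule) f z ->
  ex_derive (K := C_AbsRing) (V := C_NormedModule) g z -> g z <> 0 ->
  ex_derive (K := C_AbsRing) (V := C_NormedModule) (fun y => f y / g y) z.
Proof.
intros [f' Hf%is_derive_C_AbsRing] [g' Hg%is_derive_C_AbsRing] Hgz.
pose proof (proj1 (is_derive_C_AbsRing _ _ _) (is_derive_Cinv (g z) Hgz)) as Hinv.
pose proof (is_derive_comp (K := C_AbsRing) (V := AbsRing_NormedModule C_AbsRing)
  Cinv g z _ _ Hinv Hg) as Hg'.
eexists; apply is_derive_C_AbsRing.
exact (is_derive_mult (K := C_AbsRing) f (fun y => / g y) z _ _ Hf Hg' Cmult_comm).
Qed.

Lemma is_derive_Re_ray (p : C -> C) (z l : C) (t : R) :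
  is_derive (K := C_AbsRing) (V := C_NormedModule) p (RtoC t * z) l ->
  is_derive (fun s : R => Re (p (RtoC s * z))) t (Re (z * l)).
Proof.
intros H; apply is_derive_Reals; intros eps Heps.
pose proof (Cmod_ge_0 z) as Hz.
(* The divisor [Cmod z + 1] stays positive at [z = 0] and absorbs the factor [|z|] of the increment
   [h z]. *)
assert (He : (0 < eps / (Cmod z + 1) / 2)%R).
{ apply Rdiv_lt_0_compat; [apply Rdiv_lt_0_compat |]; lra. }
destruct (proj1 (is_derive_C_eps _ _ _) H (mkposreal _ He)) as [d Hd]; simpl in Hd.
assert (Hd' : (0 < d / (Cmod z + 1))%R)
  by (apply Rdiv_lt_0_compat; [apply cond_pos | lra]).
exists (mkposreal _ Hd'); intros h Hh0 Hh; simpl in Hh.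
apply Rabs_pos_lt in Hh0 as Hh1.
assert (Hh2 : (Rabs h * (Cmod z + 1) < d)%R) by (apply Rlt_div_r in Hh; lra).
specialize (Hd (RtoC (t + h) * z)).
replace (RtoC (t + h) * z - RtoC t * z) with (RtoC h * z) in Hd
  by (rewrite RtoC_plus; ring).
rewrite (Cmod_mult (RtoC h) z), Cmod_R in Hd.
specialize (Hd ltac:(nra)).
pose proof (Rle_trans _ _ _ (re_le_Cmod _) Hd) as Hr.
replace ((Re (p (RtoC (t + h) * z)%C) - Re (p (RtoC t * z)%C)) / h - Re (z * l)%C)%R
  with (Re (p (RtoC (t + h) * z) - p (RtoC t * z) - RtoC h * z * l)%C / h)%R.
2:{ unfold Re; simpl; field; assumption. }
rewrite Rabs_div by assumption.
apply Rlt_div_l; [assumption |].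
apply Rle_lt_trans with (1 := Hr).
assert (eps / (Cmod z + 1) / 2 * (Cmod z + 1) = eps / 2)%R by (field; lra).
nra.
Qed.

(** Suppose [g t1 <= 0] and let [m] be the supremum of the points of [[a, t1]] up to which [g] is
    positive. By continuity, [g m < 0] contradicts positivity to the left of [m], and [g m > 0]
    extends positivity beyond [m]. If [g m = 0], the positive derivative makes [g] negative just to
    the left. *)
Lemma pos_of_deriv_pos_at_zeros (g g' : R -> R) (a b : R) :
  (forall t, (a <= t <= b)%R -> is_derive g t (g' t)) ->
  (0 < g a)%R ->
  (forall t, (a <= t <= b)%R -> g t = 0%R -> (0 < g' t)%R) ->
  forall t, (a <= t <= b)%R -> (0 < g t)%R.
Proof.
intros Hg Ha Hz t1 Ht1.
destruct (Rlt_le_dec 0 (g t1)) as [H|Hneg]; [exact H | exfalso].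
set (E := fun t => (a <= t <= t1)%R /\ forall s, (a <= s <= t)%R -> (0 < g s)%R).
assert (Ea : E a).
{ split; [lra |]; intros s Hs; now replace s with a by lra. }
destruct (completeness E) as [m [Hub Hlub]].
{ exists t1; intros t [Ht _]; lra. }
{ now exists a. }
assert (Ham : (a <= m)%R) by now apply Hub.
assert (Hm1 : (m <= t1)%R) by (apply Hlub; intros t [Ht _]; lra).
assert (Hbelow : forall s, (a <= s < m)%R -> (0 < g s)%R).
{ intros s Hs.
  destruct (classic (exists t, E t /\ (s <= t)%R)) as [[t [[_ Et] Hst]]|N].
  - apply Et; lra.
  (* A point that no element of [E] reaches is an upper bound of [E]. *)
  - assert (m <= s)%R; [| lra].
    apply Hlub; intros t Et; apply Rnot_lt_le; intros Hst.
    apply N; exists t; split; [assumption | lra]. }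
pose proof (Hg m ltac:(lra)) as Dm.
assert (Cm : continuous g m) by (apply (ex_derive_continuous (V := R_NormedModule)); now exists (g' m)).
destruct (Rtotal_order (g m) 0) as [Hlt|[Heq|Hgt]].
- assert (Ham' : (a < m)%R) by (destruct (Req_dec a m); [subst; lra | lra]).
  destruct (Cm (fun y => (y < 0)%R) (open_lt 0 _ Hlt)) as [d Hd].
  pose proof (cond_pos d).
  set (s := Rmax a (m - d / 2)).
  assert (Hs : (a <= s < m)%R /\ (m - d / 2 <= s)%R)
    by (unfold s, Rmax; destruct Rle_dec; lra).
  assert (g s < 0)%R.
  { apply Hd; change (Rabs (s - m) < d)%R; apply Rabs_lt_between; lra. }
  specialize (Hbelow s ltac:(lra)); lra.
- assert (Ham' : (a < m)%R) by (destruct (Req_dec a m); [subst; lra | lra]).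
  specialize (Hz m ltac:(lra) Heq).
  apply is_derive_Reals in Dm.
  (* Tolerance [g' m] keeps the difference quotient positive near [m]. *)
  destruct (Dm (g' m) Hz) as [d Hd].
  pose proof (cond_pos d).
  set (s := Rmax a (m - d / 2)).
  assert (Hs : (a <= s < m)%R /\ (m - d / 2 <= s)%R)
    by (unfold s, Rmax; destruct Rle_dec; lra).
  specialize (Hd (s - m)%R ltac:(lra) ltac:(apply Rabs_lt_between; lra)).
  replace (m + (s - m))%R with s in Hd by ring.
  apply Rabs_lt_between in Hd; rewrite Heq in Hd.
  assert (Q : (0 < (g s - 0) / (s - m))%R) by lra.
  specialize (Hbelow s ltac:(lra)).
  assert (/ (s - m) < 0)%R by (apply Rinv_lt_0_compat; lra).
  unfold Rdiv in Q; nra.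
- destruct (Cm (fun y => (0 < y)%R) (open_gt 0 _ Hgt)) as [d Hd].
  pose proof (cond_pos d).
  (* Since [g t1 <= 0 < g m], there is room to the right of [m]. *)
  assert (Hm1' : (m < t1)%R) by (destruct (Req_dec m t1); [subst; lra | lra]).
  set (s := Rmin t1 (m + d / 2)).
  assert (Hs : (m < s <= t1)%R /\ (s <= m + d / 2)%R)
    by (unfold s, Rmin; destruct Rle_dec; lra).
  assert (E s); [split; [lra |] | specialize (Hub s ltac:(assumption)); lra].
  intros r Hr; destruct (Rlt_le_dec r m) as [Hrm|Hrm]; [apply Hbelow; lra |].
  apply Hd; change (Rabs (r - m) < d)%R; apply Rabs_lt_between; lra.
Qed.

(** In the real part, the bound [Im w ^ 2 < 1 - Re w ^ 2] leaves a lower bound that is the perfect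
    square [(1 + 2 Re w)^2 / 3]. *)
Lemma Re_phi_CAR_pos (w : C) : unit_disc w -> (0 < Re (phi_CAR w))%R.
Proof.
intros Hw; unfold unit_disc in Hw.
pose proof (Cmod2_alt w) as Hsq; pose proof (Cmod_ge_0 w).
assert (Cmod w ^ 2 < 1)%R by nra.
replace (Re (phi_CAR w))
  with (1 + 4 / 3 * Re w + 2 / 3 * (Re w ^ 2 - Im w ^ 2))%R
  by (unfold phi_CAR, Re, Im; simpl; field).
pose proof (pow2_ge_0 (1 + 2 * Re w)); nra.
Qed.

(* At [p0 = 0] the quotient has the junk value [0], which makes the last
   hypothesis false. *)
Lemma Re_deriv_pos_of_Re_zero (beta : R) (p0 m : C) :
  (beta <= 0)%R -> Re p0 = 0%R ->
  (0 < Re (p0 + RtoC beta * (m / p0 ^ 2)))%R -> (0 < Re m)%R.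
Proof.
intros Hb Hp H; destruct p0 as [x y]; destruct m as [s t].
unfold Re in Hp; simpl in Hp; subst x.
destruct (Req_dec y 0) as [->|Hy].
- exfalso.
  assert (E : / ((0, 0)%R ^ 2) = 0)
    by (apply injective_projections; simpl; unfold Rdiv; ring).
  unfold Cdiv in H; rewrite E in H; simpl in H; lra.
- unfold Re in *; simpl in *.
  (* Since [(i y)^2 = - y^2] is real, only [s], the real part of [m], survives. *)
  match type of H with (0 < ?e)%R =>
    replace e with (- beta * s * / (y * y))%R in H by (field; nra) end.
  assert (0 < / (y * y))%R by (apply Rinv_0_lt_compat; nra).
  apply Rnot_le_lt; intros Hs.
  assert (- beta * s <= 0)%R by nra.
  nra.
Qed.

Lemma subordinate_Moebius_of_Re_pos (p : C -> C) :
  analytic_on_disc p -> p 0 = 1 ->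
  (forall z, unit_disc z -> (0 < Re (p z))%R) ->
  subordinate p (fun z => (1 + z) / (1 - z)).
Proof.
intros Hp Hp0 Hpos.
assert (Hne : forall z, unit_disc z -> p z + 1 <> 0).
{ intros z Hz E; apply (f_equal Re) in E; specialize (Hpos z Hz).
  unfold Re in *; simpl in E; lra. }
split; [exact Hp | split].
- intros z Hz.
  assert (H1 : 1 - z <> 0).
  { intros E; apply Ceq_minus in E; subst z.
    unfold unit_disc in Hz; rewrite Cmod_1 in Hz; lra. }
  assert (ex_id : ex_derive (K := C_AbsRing) (V := C_NormedModule) (fun y => y) z)
    by (exists (RtoC 1); apply is_derive_C_AbsRing, (is_derive_id (K := C_AbsRing))).
  apply ex_derive_Cdiv; [| | exact H1].
  + apply (ex_derive_plus (K := C_AbsRing) (V := C_NormedModule));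
      [apply ex_derive_const | exact ex_id].
  + apply (ex_derive_minus (K := C_AbsRing) (V := C_NormedModule));
      [apply ex_derive_const | exact ex_id].
- exists (fun z => (p z - 1) / (p z + 1)); repeat split.
  + intros z Hz; apply ex_derive_Cdiv; [| | now apply Hne].
    * apply (ex_derive_minus (K := C_AbsRing) (V := C_NormedModule));
        [now apply Hp | apply ex_derive_const].
    * apply (ex_derive_plus (K := C_AbsRing) (V := C_NormedModule));
        [now apply Hp | apply ex_derive_const].
  + intros z Hz; unfold unit_disc.
    specialize (Hne z Hz); specialize (Hpos z Hz).
    rewrite Cmod_div by assumption.
    apply Rlt_div_l; [now apply Cmod_gt_0 |]; rewrite Rmult_1_l.
    (* After squaring, the gap is [|p z + 1|^2 - |p z - 1|^2 = 4 Re (p z)]. *)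
    apply Rsqr_incrst_0; try apply Cmod_ge_0.
    rewrite !Rsqr_pow2, !Cmod2_alt.
    unfold Re, Im in *; simpl; nra.
  + rewrite Hp0; unfold Cdiv; ring.
  + intros z Hz; field.
    specialize (Hne z Hz); split; [assumption |].
    (* The denominator [1 - w], cleared of [p z + 1], is the constant [2]. *)
    intros E.
    assert (RtoC 2 = 0) by (rewrite <- E; ring).
    apply RtoC_inj in H; lra.
Qed.

Theorem theorem3p9 :
  forall (beta : R) (p : C -> C),
    (beta <= 0)%R ->
    analytic_on_disc p ->
    p 0 = 1 ->
    subordinate (fun z : C => p z + RtoC beta * (z * C_derive p z / p z ^ 2))
                phi_CAR ->
    subordinate p (fun z : C => (1 + z) / (1 - z)).
Proof.
intros beta p Hbeta Hp Hp0 (_ & _ & w & _ & Hw & _ & Hsub).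
apply subordinate_Moebius_of_Re_pos; [assumption .. |].
intros z Hz.
assert (Hray : forall t, (0 <= t <= 1)%R -> unit_disc (RtoC t * z)).
{ intros t Ht; unfold unit_disc in *; rewrite Cmod_mult, Cmod_R, Rabs_pos_eq by lra.
  pose proof (Cmod_ge_0 z); nra. }
(* The goal becomes the endpoint [t = 1] of the ray through [z]. *)
rewrite <- (Cmult_1_l z).
apply (pos_of_deriv_pos_at_zeros
  (fun t => Re (p (RtoC t * z)))
  (fun t => Re (z * C_derive p (RtoC t * z))) 0 1); [| | | lra].
- intros t Ht; apply is_derive_Re_ray, C_derive_correct; auto.
- rewrite Cmult_0_l, Hp0; simpl; lra.
- intros t Ht Hzero.
  assert (H : (0 < Re (RtoC t * z * C_derive p (RtoC t * z)))%R).
  { apply (Re_deriv_pos_of_Re_zero beta (p (RtoC t * z))); [assumption .. |].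
    rewrite (Hsub (RtoC t * z)) by auto.
    apply Re_phi_CAR_pos; auto. }
  (* The real factor [t >= 0] comes out of the real part, so positivity of the product passes to the
     radial derivative. *)
  rewrite <- Cmult_assoc, re_scal_l in H; nra.
Qed.
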